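(* Let $m,n,p,r$ be positive integers with $p<mn$, $r<\min(m,n)$ and $3r\le \min(m,n)$. Let $\mathcal{A}:\mathbb{R}^{m\times n}\to\mathbb{R}^p$ be a linear map with restricted isometry constants $R_{2r}$ and $R_{3r}$, where $R_{2r}<1$. Let $X\in\mathbb{R}^{m\times n}$ have $\operatorname{rank}(X)=r$ and let $y=\mathcal{A}(X)$. Define $$\gamma=\frac{4R_{2r}+2R_{3r}}{1-R_{2r}}+\frac{4R_{2r}}{\sigma_{\min}(X)}\|X\|_F .$$ If $\gamma<1$, then the iterates $(X_l)_{l\ge 0}$ of the Riemannian gradient descent algorithm (described in the context) with initial point $X_0=\mathcal{H}_r(\mathcal{A}^*(y))$ satisfy $$\|X_l-X\|_F\le \gamma^{\,l}\,\|X_0-X\|_F\qquad\text{for all } l\ge 0 .$$ In particular, the condition $\gamma<1$ is satisfied whenever $$R_{3r}\le \frac{\sigma_{\min}(X)}{\sigma_{\max}(X)}\cdot\frac{1}{12\sqrt{r}} .$$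
   Context: Matrices are real, $Z^*$ is the transpose, $\langle Y,Z\rangle=\operatorname{trace}(Y^*Z)$, $\|\cdot\|_F$ is the Frobenius norm, and $\mathcal{A}^*$ is the adjoint of $\mathcal{A}$. For a rank $r$ matrix $X$, $\sigma_{\max}(X)$ is its largest singular value and $\sigma_{\min}(X)$ its smallest nonzero singular value (the $r$-th singular value). Restricted isometry constant: for an integer $0<k\le\min(m,n)$, $R_k$ is the smallest number such that $(1-R_k)\|Z\|_F^2\le\|\mathcal{A}(Z)\|_2^2\le(1+R_k)\|Z\|_F^2$ for all $Z\in\mathbb{R}^{m\times n}$ of rank at most $k$. Hard thresholding: $\mathcal{H}_r(Z)$ is obtained from a singular value decomposition of $Z$ by setting all but the $r$ largest singular values to zero (ties are broken arbitrarily); it is a best rank-$r$ approximation of $Z$ in Frobenius norm. Tangent space: if $X_l=U_l\Sigma_lV_l^*$ is a reduced singular value decomposition with $U_l\in\mathbb{R}^{m\times r}$, $\Sigma_l\in\mathbb{R}^{r\times r}$, $V_l\in\mathbb{R}^{n\times r}$, then $\mathcal{S}_l=\{U_lR^*+LV_l^*: L\in\mathbb{R}^{m\times r},\,R\in\mathbb{R}^{n\times r}\}$, and $\mathcal{P}_{\mathcal{S}_l}$ is the orthogonal projection onto $\mathcal{S}_l$: $\mathcal{P}_{\mathcal{S}_l}(Z)=U_lU_l^*Z+ZV_lV_l^*-U_lU_l^*ZV_lV_l^*$. Riemannian gradient descent: given $X_0$, for $l=0,1,2,\dots$ set $G_l=\mathcal{A}^*(y-\mathcal{A}(X_l))$;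 $\alpha_l=\|\mathcal{P}_{\mathcal{S}_l}(G_l)\|_F^2/\|\mathcal{A}\mathcal{P}_{\mathcal{S}_l}(G_l)\|_2^2$; $W_l=X_l+\alpha_l\mathcal{P}_{\mathcal{S}_l}(G_l)$; $X_{l+1}=\mathcal{H}_r(W_l)$. (If $\mathcal{P}_{\mathcal{S}_l}(G_l)=0$, then $W_l=X_l$ and $X_{l+1}=X_l$.) *)

(* Defs.v *)
From HB Require Import structures.
From mathcomp Require Import all_boot all_order all_algebra.
From mathcomp Require Import all_classical all_reals.
Set Implicit Arguments.
Unset Strict Implicit.
Unset Printing Implicit Defensive.
Import Order.TTheory GRing.Theory Num.Theory.
Local Open Scope ring_scope.

Section Definitions.
Variable R : realType.

Definition inner m n (Y Z : 'M[R]_(m, n)) : R := \tr (Y^T *m Z).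

(* On column vectors this is the Euclidean norm. *)
Definition normF m n (Z : 'M[R]_(m, n)) : R := Num.sqrt (inner Z Z).

(* See [inner_adjoint] for the characteristic property. *)
Definition adjoint m n p (A : {linear 'M[R]_(m, n) -> 'cV[R]_p}) (z : 'cV[R]_p)
  : 'M[R]_(m, n) := \matrix_(i, j) inner (A (delta_mx i j)) z.

Definition rip_bound m n p (A : {linear 'M[R]_(m, n) -> 'cV[R]_p}) (k : nat)
    (d : R) : Prop :=
  forall Z : 'M[R]_(m, n), (\rank Z <= k)%N ->
    (1 - d) * normF Z ^+ 2 <= normF (A Z) ^+ 2 <= (1 + d) * normF Z ^+ 2.

(* The infimum is attained: see [ric_least]. *)
Definition ric m n p (A : {linear 'M[R]_(m, n) -> 'cV[R]_p}) (k : nat) : R :=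
  inf [set d : R | rip_bound A k d].

(* Singular value decomposition Z = U diag(s) V^T with k (possibly zero)
   singular values in nonincreasing order. For k = minn m n this exists for
   every Z and s lists all the singular values of Z; for k = r <= minn m n it
   exists iff
   \rank Z <= r, and it is the reduced decomposition when \rank Z = r. *)
Definition is_svd m n k (Z : 'M[R]_(m, n))
    (U : 'M[R]_(m, k)) (s : 'rV[R]_k) (V : 'M[R]_(n, k)) : Prop :=
  [/\ U^T *m U = 1%:M, V^T *m V = 1%:M,
      forall i, 0 <= s 0 i,
      forall i j : 'I_k, (i <= j)%N -> s 0 j <= s 0 i
    & Z = U *m diag_mx s *m V^T].

Definition singular_value m n (Z : 'M[R]_(m, n)) (t : R) : Prop :=
  exists (U : 'M[R]_(m, minn m n)) (s : 'rV[R]_(minn m n))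
         (V : 'M[R]_(n, minn m n)),
    is_svd Z U s V /\ exists i, t = s 0 i.

(* The set of singular values of a matrix is finite, so that the supremum and
   the infimum below are a maximum and (if Z <> 0) a minimum. *)
Definition sigma_max m n (Z : 'M[R]_(m, n)) : R :=
  sup [set t : R | singular_value Z t].

Definition sigma_min m n (Z : 'M[R]_(m, n)) : R :=
  inf [set t : R | singular_value Z t /\ t != 0].

(* [hard_threshold r Z H]: H is a possible value of H_r(Z). It is a relation
   because the decomposition, hence the way ties are broken, is arbitrary. *)
Definition hard_threshold m n (r : nat) (Z H : 'M[R]_(m, n)) : Prop :=
  exists (U : 'M[R]_(m, minn m n)) (s : 'rV[R]_(minn m n))
         (V : 'M[R]_(n, minn m n)),
    is_svd Z U s V /\
    H = U *m diag_mx (\row_i (if (i < r)%N then s 0 i else 0)) *m V^T.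

Definition tangent_space m n r (U : 'M[R]_(m, r)) (V : 'M[R]_(n, r))
  : set 'M[R]_(m, n) :=
  [set Z | exists (L : 'M[R]_(m, r)) (M : 'M[R]_(n, r)),
             Z = U *m M^T + L *m V^T].

(* The orthogonal projection onto [tangent_space U V] when U and V have
   orthonormal columns: see [proj_tangentP]. *)
Definition proj_tangent m n r (U : 'M[R]_(m, r)) (V : 'M[R]_(n, r))
    (Z : 'M[R]_(m, n)) : 'M[R]_(m, n) :=
  U *m U^T *m Z + Z *m V *m V^T - U *m U^T *m Z *m V *m V^T.

(* If P = 0 then alpha = 0 / 0 = 0, W = X and the new iterate is X. *)
Definition rgd_step m n p r (A : {linear 'M[R]_(m, n) -> 'cV[R]_p})
    (y : 'cV[R]_p) (X X' : 'M[R]_(m, n)) : Prop :=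
  exists (U : 'M[R]_(m, r)) (s : 'rV[R]_r) (V : 'M[R]_(n, r)),
    is_svd X U s V /\
    let G := adjoint A (y - A X) in
    let P := proj_tangent U V G in
    let alpha := normF P ^+ 2 / normF (A P) ^+ 2 in
    let W := X + alpha *: P in
    hard_threshold r W X'.

Definition rgd_iterates m n p r (A : {linear 'M[R]_(m, n) -> 'cV[R]_p})
    (y : 'cV[R]_p) (Xs : nat -> 'M[R]_(m, n)) : Prop :=
  hard_threshold r (adjoint A y) (Xs 0%N) /\
  forall l : nat, rgd_step r A y (Xs l) (Xs l.+1).

Definition rgd_gamma m n p r (A : {linear 'M[R]_(m, n) -> 'cV[R]_p})
    (X : 'M[R]_(m, n)) : R :=
  (4 * ric A (2 * r)%N + 2 * ric A (3 * r)%N) / (1 - ric A (2 * r)%N) +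
  4 * ric A (2 * r)%N / sigma_min X * normF X.

End Definitions.

Section Sanity.
Variable R : realType.
Implicit Types m n p : nat.

Lemma innerE m n (Y Z : 'M[R]_(m, n)) :
  inner Y Z = \sum_i \sum_j Y i j * Z i j.
Proof.
rewrite /inner /mxtrace exchange_big /=; apply: eq_bigr => j _.
by rewrite !mxE; apply: eq_bigr => i _; rewrite mxE.
Qed.

Lemma inner_ge0 m n (Z : 'M[R]_(m, n)) : 0 <= inner Z Z.
Proof.
by rewrite innerE; do 2!apply: sumr_ge0 => ? _; rewrite -expr2 sqr_ge0.
Qed.

Lemma normF_sqr m n (Z : 'M[R]_(m, n)) : normF Z ^+ 2 = inner Z Z.
Proof. by rewrite sqr_sqrtr // inner_ge0. Qed.

Lemma linear_delta_sum m n p (A : {linear 'M[R]_(m, n) -> 'cV[R]_p}) Z :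
  A Z = \sum_i \sum_j Z i j *: A (delta_mx i j).
Proof.
rewrite {1}(matrix_sum_delta Z) linear_sum; apply: eq_bigr => i _.
by rewrite linear_sum; apply: eq_bigr => j _; rewrite linearZ.
Qed.

Lemma inner_adjoint m n p (A : {linear 'M[R]_(m, n) -> 'cV[R]_p}) Z z :
  inner (A Z) z = inner Z (adjoint A z).
Proof.
rewrite (innerE Z) {1}/inner linear_delta_sum !linear_sum mulmx_suml linear_sum.
apply: eq_bigr => i _; rewrite !linear_sum mulmx_suml linear_sum.
by apply: eq_bigr => j _; rewrite linearZ -scalemxAl linearZ mxE.
Qed.

Lemma normF_entry m n (Z : 'M[R]_(m, n)) i j : `|Z i j| <= normF Z.
Proof.
rewrite -ler_sqr ?nnegrE ?sqrtr_ge0 // normF_sqr innerE real_normK ?num_real //.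
rewrite (bigD1 i) //= (bigD1 j) //= -addrA expr2 lerDl addr_ge0 //.
  by apply: sumr_ge0 => k _; rewrite -expr2 sqr_ge0.
by do 2!apply: sumr_ge0 => ? _; rewrite -expr2 sqr_ge0.
Qed.

Lemma linear_bounded m n p (A : {linear 'M[R]_(m, n) -> 'cV[R]_p}) :
  exists C : R, 0 <= C /\ forall Z, normF (A Z) ^+ 2 <= C * normF Z ^+ 2.
Proof.
pose b k := \sum_i \sum_j `|A (delta_mx i j) k 0|.
exists (\sum_k b k ^+ 2); split; first by apply: sumr_ge0 => k _; exact: sqr_ge0.
move=> Z; rewrite normF_sqr innerE mulr_suml; apply: ler_sum => k _.
rewrite big_ord_recl big_ord0 addr0 -expr2 -exprMn.
rewrite -[X in X <= _]real_normK ?num_real // ler_sqr ?nnegrE //; last first.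
  rewrite mulr_ge0 ?sqrtr_ge0 //; by do 2!apply: sumr_ge0 => ? _.
rewrite linear_delta_sum summxE (le_trans (ler_norm_sum _ _ _)) // mulr_suml.
apply: ler_sum => i _; rewrite summxE (le_trans (ler_norm_sum _ _ _)) //.
rewrite mulr_suml; apply: ler_sum => j _.
by rewrite mxE normrM mulrC ler_wpM2l // normF_entry.
Qed.

Lemma ric_least m n p (A : {linear 'M[R]_(m, n) -> 'cV[R]_p}) k :
    (0 < m)%N -> (0 < n)%N -> (0 < k)%N ->
  rip_bound A k (ric A k) /\ forall d, rip_bound A k d -> ric A k <= d.
Proof.
move=> m0 n0 k0; pose S := [set d : R | rip_bound A k d]%classic.
have lbS : lbound S 0.
  move=> d /(_ (delta_mx (Ordinal m0) (Ordinal n0))).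
  rewrite mxrank_delta => /(_ k0) /andP[le1 le2].
  set N := normF (delta_mx _ _) ^+ 2 in le1 le2.
  have N0 : 0 < N.
    have := normF_entry (delta_mx (Ordinal m0) (Ordinal n0) : 'M[R]_(m, n))
      (Ordinal m0) (Ordinal n0).
    rewrite mxE !eqxx normr1 => /(lt_le_trans ltr01) Np.
    by rewrite exprn_gt0.
  have := le_trans le1 le2; rewrite ler_pM2r // => h.
  by move: h; rewrite lerD2l -subr_ge0 opprK -mulr2n pmulrn_lge0.
have nS : (S !=set0)%classic.
  have [C [C0 hC]] := linear_bounded A.
  exists (1 + C) => Z _; apply/andP; split.
    rewrite opprD addrA subrr sub0r mulNr.
    apply: (@le_trans _ _ 0); last exact: sqr_ge0.
    by rewrite oppr_le0 mulr_ge0 ?sqr_ge0.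
  apply: le_trans (hC Z) _; apply: ler_wpM2r; first exact: sqr_ge0.
  by rewrite addrA lerDr addr_ge0.
have hS : has_inf S by split=> //; exists 0.
split; last by move=> d Sd; apply: ge_inf => //; exists 0.
move=> Z rZ; set N := normF Z ^+ 2; set M := normF (A Z) ^+ 2.
have approx e : 0 < e -> exists2 d, S d & d < ric A k + e.
  by move=> e0; exact: inf_adherent.
have N0 : 0 <= N by exact: sqr_ge0.
have close a b : (forall e, 0 < e -> a <= b + e * N) -> a <= b.
  move=> h; apply/ler_addgt0Pr => e e0.
  have N1 : 0 < N + 1 by rewrite ltr_wpDl.
  apply: le_trans (h (e / (N + 1)) (divr_gt0 e0 N1)) _.
  rewrite lerD2l mulrAC ler_pdivrMr // ler_wpM2l ?ltW //.
  by rewrite ltrDl.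
apply/andP; split; apply: close => e e0;
  have [d /(_ Z rZ) /andP[h1 h2] lt_d] := approx e e0.
- rewrite -lerBlDr -mulrBl; apply: le_trans h1; apply: ler_wpM2r => //.
  by rewrite -addrA -opprD lerD2l lerN2 ltW.
- rewrite -mulrDl; apply: le_trans h2 _; apply: ler_wpM2r => //.
  by rewrite -addrA lerD2l ltW.
Qed.

Lemma proj_tangentP m n r (U : 'M[R]_(m, r)) (V : 'M[R]_(n, r)) Z :
    U^T *m U = 1%:M -> V^T *m V = 1%:M ->
  tangent_space U V (proj_tangent U V Z) /\
  forall T, tangent_space U V T -> inner T (Z - proj_tangent U V Z) = 0.
Proof.
move=> hU hV; split.
  exists (Z *m V - U *m U^T *m Z *m V), (Z^T *m U).
  by rewrite trmx_mul trmxK mulmxBl /proj_tangent !mulmxA addrA.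
move=> _ [L [M ->]]; set D := Z - _.
have UD : U^T *m D = 0.
  by rewrite /D /proj_tangent !(mulmxBr, mulmxDr) !mulmxA hU !mul1mx addrK subrr.
have DV : D *m V = 0.
  rewrite /D /proj_tangent !(mulmxBl, mulmxDl) -!(mulmxA _ V^T V) hV.
  by rewrite !mulmx1 addrAC subrr add0r subrr.
rewrite /inner [(_ + _)^T]raddfD /= !trmx_mul !trmxK mulmxDl mxtraceD -mulmxA UD mulmx0.
by rewrite mxtrace0 add0r -mulmxA mxtrace_mulC -mulmxA DV mulmx0 mxtrace0.
Qed.

End Sanity.

(* Main.v *)
Require Import Defs.
From HB Require Import structures.
From mathcomp Require Import all_boot all_order all_algebra.
From mathcomp Require Import all_classical all_reals.
From mathcomp Require Import perm complex.
From mathcomp Require Import ring lra.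
Set Implicit Arguments.
Unset Strict Implicit.
Unset Printing Implicit Defensive.
Import Order.TTheory GRing.Theory Num.Theory.
Local Open Scope ring_scope.

(* Let T = X_l - X, D = P_S(T) and N = T - D. Since P_S(G_l) = -P_S A^*A T,
   W_l - X = (D + alpha P_S(G_l)) + N, and testing the first summand E against
   itself gives |E|^2 = (<E,D> - alpha <AE,AD>) + alpha (<E,N> - <AE,AN>).
   Restricted isometry, polarized on S (rank <= 2r) and on S plus the line of N
   (rank <= 3r), bounds the two brackets by 2 R_2r / (1 - R_2r) |E| |D| and
   R_3r |E| |N|. As N = -(I - UU^T) X (I - VV^T), |N| <= |T|^2 / sigma_min(X).
   X_{l+1} is a best rank r approximation of W_l, so |X_{l+1} - X| is at most
   2 |W_l - X|. The same argument at the start gives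
   |X_0 - X| <= 2 R_2r |X|, which turns the quadratic term into the last term
   of gamma. *)

(** * Spectral theorem for Hermitian matrices *)

(** If the whole spectral diagonal vanished, so would [S]; a row of the invertible [spectralmx S] is
    an eigenvector for a nonzero entry. *)
Lemma hermitian_eigenvalue_neq0 (C : numClosedFieldType) n (S : 'M[C]_n) :
  S \is hermsymmx -> S != 0 ->
  exists2 d, d \is Num.real & d != 0 /\ eigenvalue S d.
Proof.
move=> herm S0; have /orthomx_spectralP SE := hermitian_normalmx herm.
have dreal := hermitian_spectral_diag_real herm.
set P := spectralmx S in SE; set d := spectral_diag S in SE dreal.
have Pu : P \in unitmx by exact: spectral_unit.
have [i di0] : exists i, d 0 i != 0.
  apply/existsP; apply: contraNT S0; rewrite negb_exists => /forallP d0.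
  have {}d0 : d = 0.
    by apply/rowP => i; rewrite mxE; apply/eqP; move: (d0 i); rewrite negbK.
  rewrite SE d0 (_ : diag_mx 0 = 0) ?mulmx0 ?mul0mx //.
  by apply/matrixP => a b; rewrite !mxE mul0rn.
exists (d 0 i); first exact: (mxOverP dreal).
split=> //; apply/eigenvalueP; exists (row i P).
  have PS : P *m S = diag_mx d *m P by rewrite {1}SE !mulmxA mulmxV ?mul1mx.
  by rewrite -row_mul PS row_mul row_diag_mx -scalemxAl -rowE.
apply/eqP => Pi0; have := row_free_unit P; rewrite Pu => /row_free_injr.
move=> /(_ 1%N (delta_mx 0 i) 0) /=; rewrite -rowE Pi0 mul0mx => /(_ erefl).
by move/matrixP/(_ 0 i); rewrite !mxE !eqxx => /eqP; rewrite oner_eq0.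
Qed.

Section RiemannianGradientDescent.
Variable R : realType.
Implicit Types m n p k r : nat.

(** * Trace inner product and Frobenius norm *)

Lemma innerC m n (Y Z : 'M[R]_(m, n)) : inner Y Z = inner Z Y.
Proof. by rewrite /inner -mxtrace_tr trmx_mul trmxK. Qed.

Lemma innerDr m n (Y Z W : 'M[R]_(m, n)) :
  inner Y (Z + W) = inner Y Z + inner Y W.
Proof. by rewrite /inner mulmxDr mxtraceD. Qed.

Lemma innerZr m n a (Y Z : 'M[R]_(m, n)) : inner Y (a *: Z) = a * inner Y Z.
Proof. by rewrite /inner -scalemxAr mxtraceZ. Qed.

Lemma innerNr m n (Y Z : 'M[R]_(m, n)) : inner Y (- Z) = - inner Y Z.
Proof. by rewrite -scaleN1r innerZr mulN1r. Qed.

Lemma innerBr m n (Y Z W : 'M[R]_(m, n)) :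
  inner Y (Z - W) = inner Y Z - inner Y W.
Proof. by rewrite innerDr innerNr. Qed.

Lemma innerDl m n (Y Z W : 'M[R]_(m, n)) :
  inner (Y + Z) W = inner Y W + inner Z W.
Proof. by rewrite innerC innerDr !(innerC W). Qed.

Lemma innerZl m n a (Y Z : 'M[R]_(m, n)) : inner (a *: Y) Z = a * inner Y Z.
Proof. by rewrite innerC innerZr innerC. Qed.

Lemma innerNl m n (Y Z : 'M[R]_(m, n)) : inner (- Y) Z = - inner Y Z.
Proof. by rewrite innerC innerNr innerC. Qed.

Definition inner_lin := (innerDl, innerDr, innerNl, innerNr, innerZl, innerZr).

Lemma inner0r m n (Y : 'M[R]_(m, n)) : inner Y 0 = 0.
Proof. by rewrite /inner mulmx0 mxtrace0. Qed.

Lemma inner_mull m n k (M : 'M[R]_(m, k)) (Y : 'M[R]_(k, n)) Z :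
  inner (M *m Y) Z = inner Y (M^T *m Z).
Proof. by rewrite /inner trmx_mul mulmxA. Qed.

Lemma inner_mulr m n k (Y : 'M[R]_(m, k)) (M : 'M[R]_(k, n)) Z :
  inner (Y *m M) Z = inner Y (Z *m M^T).
Proof. by rewrite /inner trmx_mul -mulmxA mxtrace_mulC mulmxA. Qed.

Lemma normF_ge0 m n (Z : 'M[R]_(m, n)) : 0 <= normF Z.
Proof. exact: sqrtr_ge0. Qed.

Lemma normF_eq0 m n (Z : 'M[R]_(m, n)) : (normF Z == 0) = (Z == 0).
Proof.
apply/eqP/eqP => [Z0|->]; last by rewrite /normF inner0r sqrtr0.
apply/matrixP => i j; rewrite mxE; apply/eqP; rewrite -normr_le0 -Z0.
exact: normF_entry.
Qed.

Lemma normF0 m n : normF (0 : 'M[R]_(m, n)) = 0.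
Proof. by apply/eqP; rewrite normF_eq0. Qed.

Lemma normFZ m n a (Z : 'M[R]_(m, n)) : normF (a *: Z) = `|a| * normF Z.
Proof.
by rewrite /normF !inner_lin mulrA -expr2 sqrtrM ?sqr_ge0 // sqrtr_sqr.
Qed.

Lemma normFN m n (Z : 'M[R]_(m, n)) : normF (- Z) = normF Z.
Proof. by rewrite -scaleN1r normFZ normrN1 mul1r. Qed.

Lemma normF_tr m n (Z : 'M[R]_(m, n)) : normF Z^T = normF Z.
Proof. by rewrite /normF /inner trmxK mxtrace_mulC. Qed.

Lemma ler_normF_sqr m n k l (Y : 'M[R]_(m, n)) (Z : 'M[R]_(k, l)) :
  (normF Y <= normF Z) = (normF Y ^+ 2 <= normF Z ^+ 2).
Proof. by rewrite ler_sqr ?nnegrE ?normF_ge0. Qed.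

Lemma normF_sqrD m n (Y Z : 'M[R]_(m, n)) :
  normF (Y + Z) ^+ 2 = normF Y ^+ 2 + 2 * inner Y Z + normF Z ^+ 2.
Proof. by rewrite !normF_sqr !inner_lin (innerC Z Y); ring. Qed.

(* A symmetric bilinear form is bounded by the bound of its quadratic form:
   polarize at [normF Z *: Y] and [normF Y *: Z]. *)
Lemma polarization_bound m n p (A : {linear 'M[R]_(m, n) -> 'cV[R]_p}) (a k : R)
    (Y Z : 'M[R]_(m, n)) :
    (forall b c, let W := b *: Y + c *: Z in
       `|normF W ^+ 2 - a * normF (A W) ^+ 2| <= k * normF W ^+ 2) ->
  `|inner Y Z - a * inner (A Y) (A Z)| <= k * (normF Y * normF Z).
Proof.
move=> H; set B := inner Y Z - _; set y := normF Y; set z := normF Z.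
have [Y0|Y0] := eqVneq Y 0.
  rewrite /B /y Y0 linear0 ![inner 0 _]innerC !inner0r normF0.
  by rewrite mul0r !mulr0 subrr normr0.
have [Z0|Z0] := eqVneq Z 0.
  by rewrite /B /z Z0 linear0 !inner0r normF0 !mulr0 subrr normr0.
have y0 : 0 < y by rewrite lt_def normF_eq0 Y0 normF_ge0.
have z0 : 0 < z by rewrite lt_def normF_eq0 Z0 normF_ge0.
have yz0 : 0 < y * z by rewrite mulr_gt0.
(* For $W_\pm = zY \pm yZ$ the two forms differ by $4yzB$, while $|W_+|^2 + |W_-|^2 = 4y^2z^2$. *)
have := H z y; have := H z (- y) => /=.
rewrite !linearD !linearZ /= !normF_sqrD !normFZ !exprMn.
rewrite !real_normK ?num_real // !inner_lin -/y -/z.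
rewrite !ler_norml => /andP[h1 h2] /andP[h3 h4].
rewrite -(ler_pM2l yz0) -[B <= _](ler_pM2l yz0) {}/B.
by apply/andP; split; lra.
Qed.

(** Cauchy-Schwarz is polarization with $a = 0$ and $k = 1$, the zero map serving as [A]. *)
Lemma inner_le m n (Y Z : 'M[R]_(m, n)) : `|inner Y Z| <= normF Y * normF Z.
Proof.
have := @polarization_bound m n m (mulmxr (0 : 'cV[R]_n)) 0 1 Y Z.
rewrite /= mul0r subr0 mul1r; apply=> b c.
by rewrite mul0r subr0 mul1r ger0_norm ?sqr_ge0.
Qed.

Lemma normFD m n (Y Z : 'M[R]_(m, n)) : normF (Y + Z) <= normF Y + normF Z.
Proof.
rewrite -ler_sqr ?nnegrE ?addr_ge0 ?normF_ge0 // normF_sqrD sqrrD.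
have := inner_le Y Z => /(le_trans (ler_norm _)); lra.
Qed.

Lemma normF_sqr_sum m n (Z : 'M[R]_(m, n)) :
  normF Z ^+ 2 = \sum_i \sum_j Z i j ^+ 2.
Proof.
by rewrite normF_sqr innerE; do 2!apply: eq_bigr => ? _; rewrite expr2.
Qed.

(** Each entry of the product is the inner product of a row of [Y] and a column of [Z], to which
    Cauchy-Schwarz applies. *)
Lemma normFM m n k (Y : 'M[R]_(m, n)) (Z : 'M[R]_(n, k)) :
  normF (Y *m Z) <= normF Y * normF Z.
Proof.
rewrite -ler_sqr ?nnegrE ?mulr_ge0 ?normF_ge0 // exprMn -(normF_tr Z).
rewrite !normF_sqr_sum mulr_suml; apply: ler_sum => i _.
rewrite mulr_sumr; apply: ler_sum => j _.
have yz0 : 0 <= normF (row i Y) * normF (row j Z^T).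
  by rewrite mulr_ge0 ?normF_ge0.
have := lerXn2r 2 (normr_ge0 _ : _ \is Num.nneg) yz0
  (inner_le (row i Y) (row j Z^T)).
rewrite real_normK ?num_real // exprMn !normF_sqr_sum innerE !big_ord1 mxE.
congr (_ ^+ 2 <= _ * _); apply: eq_bigr => l _; by rewrite !mxE.
Qed.

(** * Orthogonal projections and isometries *)

Lemma normF_mul_proj m n (P : 'M[R]_n) (Z : 'M[R]_(m, n)) :
    P^T = P -> P *m P = P ->
  normF Z ^+ 2 = normF (Z *m P) ^+ 2 + normF (Z *m (1%:M - P)) ^+ 2.
Proof.
move=> PT PP; have ZE : Z = Z *m P + Z *m (1%:M - P).
  by rewrite -mulmxDr subrKC mulmx1.
rewrite {1}ZE normF_sqrD.
rewrite inner_mulr PT -mulmxA mulmxBl PP mul1mx subrr mulmx0 inner0r.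
by rewrite mulr0 addr0.
Qed.

Lemma isometry_proj n k (V : 'M[R]_(n, k)) :
  V^T *m V = 1%:M -> V *m V^T *m (V *m V^T) = V *m V^T.
Proof. by move=> VV; rewrite !mulmxA -(mulmxA V) VV mulmx1. Qed.

Lemma normF_mul_isometry_tr m n k (V : 'M[R]_(n, k)) (Z : 'M[R]_(m, k)) :
  V^T *m V = 1%:M -> normF (Z *m V^T) = normF Z.
Proof.
by move=> VV; rewrite /normF inner_mulr trmxK -mulmxA VV mulmx1.
Qed.

Lemma normF_isometry_mul m n k (U : 'M[R]_(m, k)) (Z : 'M[R]_(k, n)) :
  U^T *m U = 1%:M -> normF (U *m Z) = normF Z.
Proof. by move=> UU; rewrite /normF inner_mull mulmxA UU mul1mx. Qed.

Lemma normF_mul_isometry_le m n k (V : 'M[R]_(n, k)) (Z : 'M[R]_(m, n)) :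
  V^T *m V = 1%:M -> normF (Z *m V) <= normF Z.
Proof.
move=> VV; rewrite -(normF_mul_isometry_tr (Z *m V) VV) ler_normF_sqr -mulmxA.
have PT : (V *m V^T)^T = V *m V^T by rewrite trmx_mul trmxK.
by rewrite (normF_mul_proj Z PT (isometry_proj VV)) lerDl sqr_ge0.
Qed.

Lemma normF_mul_coproj_le m n k (V : 'M[R]_(n, k)) (Z : 'M[R]_(m, n)) :
  V^T *m V = 1%:M -> normF (Z *m (1%:M - V *m V^T)) <= normF Z.
Proof.
move=> VV; rewrite ler_normF_sqr.
have PT : (V *m V^T)^T = V *m V^T by rewrite trmx_mul trmxK.
by rewrite (normF_mul_proj Z PT (isometry_proj VV)) lerDr sqr_ge0.
Qed.

Lemma normF_mul_diag_le m k (Z : 'M[R]_(m, k)) (d : 'rV[R]_k) (c : R) :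
  0 <= c -> (forall i, `|d 0 i| <= c) -> normF (Z *m diag_mx d) <= c * normF Z.
Proof.
move=> c0 dc; rewrite -ler_sqr ?nnegrE ?mulr_ge0 ?normF_ge0 // exprMn.
rewrite !normF_sqr_sum mulr_sumr; apply: ler_sum => i _.
rewrite mulr_sumr; apply: ler_sum => j _.
rewrite mul_mx_diag mxE exprMn mulrC ler_wpM2r ?sqr_ge0 //.
by rewrite -real_normK ?num_real // ler_sqr ?nnegrE.
Qed.

(** * Existence of the singular value decomposition *)

(** Over the complex numbers [S] becomes Hermitian; its nonzero eigenvalue is real and a root of the
    same characteristic polynomial. *)
Lemma symmetric_eigenvalue_neq0 n (S : 'M[R]_n) :
  S^T = S -> S != 0 -> exists2 l, l != 0 & eigenvalue S l.
Proof.
move=> ST S0; pose c : {rmorphism R -> R[i]} := real_complex R.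
have herm : map_mx c S \is hermsymmx.
  apply: realsym_hermsym.
    by apply/is_hermitianmxP; rewrite expr0 scale1r map_mx_id // map_trmx ST.
  by apply/mxOverP => i j; rewrite mxE; apply/complex_realP; exists (S i j).
have [|d /complex_realP[l dl] [d0 Sd]] := hermitian_eigenvalue_neq0 herm.
  by rewrite map_mx_eq0.
exists l; first by apply: contraNneq d0 => l0; rewrite dl l0.
rewrite eigenvalue_root_char -(fmorph_root c) map_char_poly.
by rewrite -eigenvalue_root_char; move: Sd; rewrite dl.
Qed.

Lemma unit_vector n (w : 'cV[R]_n) : w != 0 ->
  ((normF w)^-1 *: w)^T *m ((normF w)^-1 *: w) = 1%:M.
Proof.
move=> w0; set z := _ *: w.
have tr1 (M : 'M[R]_1) : M = (\tr M)%:M by rewrite {1}[M]mx11_scalar trace_mx11.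
rewrite [LHS]tr1 -/(inner z z) -normF_sqr normFZ exprMn real_normK ?num_real //.
by rewrite exprVn mulVf // expf_neq0 // normF_eq0.
Qed.

(** A unit eigenvector $v$ of $Y^T Y$ for an eigenvalue $l \ne 0$ satisfies $l = |Yv|^2$, so $t =
    |Yv|$ and $u = Yv/t$ work. *)
Lemma singular_pair m n (Y : 'M[R]_(m, n)) : Y != 0 ->
  exists (t : R) (u : 'cV[R]_m) (v : 'cV[R]_n),
    [/\ 0 < t, u^T *m u = 1%:M, v^T *m v = 1%:M, Y *m v = t *: u
      & Y^T *m u = t *: v].
Proof.
move=> Y0; have [||l l0 /eigenvalueP[w wS w0]] :=
  @symmetric_eigenvalue_neq0 n (Y^T *m Y).
- by rewrite trmx_mul trmxK.
- have: inner Y Y != 0 by rewrite -normF_sqr expf_neq0 // normF_eq0.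
  by apply: contraNneq => S0; rewrite /inner S0 mxtrace0.
have wT0 : w^T != 0 by rewrite trmx_eq0.
pose v := (normF w^T)^-1 *: w^T.
have vv : v^T *m v = 1%:M by exact: unit_vector.
have Sv : Y^T *m (Y *m v) = l *: v.
  rewrite /v -!scalemxAr mulmxA scalerA mulrC -scalerA; congr (_ *: _).
  by apply: trmx_inj; rewrite !trmx_mul !trmxK wS linearZ /= trmxK.
have lE : l = normF (Y *m v) ^+ 2.
  rewrite normF_sqr inner_mull Sv innerZr /inner vv mxtrace1 mulr1 //.
have Yv0 : normF (Y *m v) != 0.
  by apply: contraNneq l0 => h; rewrite lE h expr0n.
exists (normF (Y *m v)), ((normF (Y *m v))^-1 *: (Y *m v)), v; split=> //.
- by rewrite lt_def Yv0 normF_ge0.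
- by apply: unit_vector; rewrite -normF_eq0.
- by rewrite scalerA divff ?scale1r.
- by rewrite -scalemxAr Sv {1}lE scalerA expr2 mulrA mulVf ?mul1r.
Qed.

(** Supplies singular vectors for the singular value 0: the left kernel of [U] is nonzero because
    [U] has fewer columns than rows. *)
Lemma orthogonal_unit_vector m k (U : 'M[R]_(m, k)) : (k < m)%N ->
  exists u : 'cV[R]_m, u^T *m u = 1%:M /\ U^T *m u = 0.
Proof.
move=> km; have : kermx U != 0.
  rewrite -mxrank_eq0 mxrank_ker subn_eq0 -ltnNge.
  exact: leq_ltn_trans (rank_leq_col _) km.
case/rowV0Pn => w /sub_kermxP wU w0.
exists ((normF w^T)^-1 *: w^T); split; first by rewrite unit_vector ?trmx_eq0.
by rewrite -scalemxAr -trmx_mul wU trmx0 scaler0.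
Qed.

(* The singular triples are extracted one at a time; the rest
   [X - U *m diag_mx s *m V^T] stays orthogonal to those already found. *)
Lemma partial_svd m n k (X : 'M[R]_(m, n)) : (k <= m)%N -> (k <= n)%N ->
  exists (U : 'M[R]_(m, k)) (s : 'rV[R]_k) (V : 'M[R]_(n, k)),
    [/\ U^T *m U = 1%:M, V^T *m V = 1%:M, forall i, 0 <= s 0 i,
        U^T *m (X - U *m diag_mx s *m V^T) = 0
      & (X - U *m diag_mx s *m V^T) *m V = 0].
Proof.
elim: k => [|k IH] km kn.
  exists 0, 0, 0; split; try by apply/matrixP => -[].
    by case.
  by apply/matrixP => ? -[].
have [U [s [V [UU VV s0 UY YV]]]] := IH (ltnW km) (ltnW kn).
set Y := X - _ in UY YV.
have [t [u [v [t0 [uu vv] [Uu Vv] Yv Yu]]]] :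
    exists (t : R) (u : 'cV[R]_m) (v : 'cV[R]_n),
    [/\ 0 <= t, u^T *m u = 1%:M /\ v^T *m v = 1%:M,
        U^T *m u = 0 /\ V^T *m v = 0, Y *m v = t *: u & Y^T *m u = t *: v].
  have [Y0|/singular_pair[t [u [v [t0 uu vv Yv Yu]]]]] := eqVneq Y 0.
    have [u [uu Uu]] := orthogonal_unit_vector U km.
    have [v [vv Vv]] := orthogonal_unit_vector V kn.
    by exists 0, u, v; split=> //; rewrite Y0 ?trmx0 mul0mx scale0r.
  (* Orthogonality to the earlier vectors is automatic: $tu = Yv$ with $U^T Y = 0$, and $tv = Y^T u$
     with $YV = 0$. *)
  exists t, u, v; split=> //; first exact: ltW.
  have tn0 : t != 0 by rewrite gt_eqF.
  split; apply: (scalerI tn0); rewrite scaler0 scalemxAr.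
    by rewrite -Yv mulmxA UY mul0mx.
  by rewrite -Yu mulmxA -trmx_mul YV trmx0 mul0mx.
have uU : u^T *m U = 0 by rewrite -[LHS]trmxK trmx_mul trmxK Uu trmx0.
have vV : v^T *m V = 0 by rewrite -[LHS]trmxK trmx_mul trmxK Vv trmx0.
pose U' : 'M[R]_(m, 1 + k) := row_mx u U.
pose V' : 'M[R]_(n, 1 + k) := row_mx v V.
pose s' : 'rV[R]_(1 + k) := row_mx (t%:M) s.
have rest : X - U' *m diag_mx s' *m V'^T = Y - t *: (u *m v^T).
  rewrite /U' /s' diag_mx_row tr_row_mx mul_row_block mul_row_col !mulmx0.
  rewrite addr0 add0r opprD addrCA addrC /Y; congr (_ - _).
  rewrite (_ : diag_mx t%:M = t%:M) ?mul_mx_scalar -?scalemxAl //.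
  by apply/matrixP => i j; rewrite !ord1 !mxE eqxx.
rewrite -[k.+1]add1n; exists U', s', V'; rewrite rest {rest}.
clearbody Y; split.
- by rewrite /U' tr_row_mx mul_col_row uu UU uU Uu -scalar_mx_block.
- by rewrite /V' tr_row_mx mul_col_row vv VV vV Vv -scalar_mx_block.
- move=> i; case: (split_ordP i) => j ->.
    by rewrite row_mxEl !mxE (ord1 j) eqxx.
  by rewrite row_mxEr.
- rewrite /U' tr_row_mx mul_col_mx !mulmxBr UY -!scalemxAr !mulmxA uu Uu.
  rewrite mul1mx mul0mx scaler0 subr0.
  rewrite -[u^T *m Y]trmxK trmx_mul trmxK Yu linearZ /= subrr.
  by rewrite col_mx0.
- rewrite /V' mul_mx_row !mulmxBl YV Yv -!scalemxAl -!mulmxA vv vV.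
  by rewrite mulmx1 mulmx0 scaler0 subrr subr0 row_mx0.
Qed.

Lemma sorting_perm k (s : 'rV[R]_k) :
  exists f : 'S_k, forall i j : 'I_k, (i <= j)%N -> s 0 (f j) <= s 0 (f i).
Proof.
pose t := [tuple s 0 i | i < k].
have /tuple_permP[f fE] : perm_eq (sort_tuple >=%O t) t by rewrite perm_sort.
exists f => i j ij.
have nthE a : s 0 (f a) = nth 0 (sort >=%O t) a.
  by rewrite fE -tnth_nth !tnth_mktuple.
have ge_trans : transitive (>=%O : rel R) by move=> y x z xy /le_trans; apply.
have srt : sorted >=%O (sort >=%O t).
  by apply: sort_sorted => x y; rewrite orbC; exact: le_total.
rewrite !nthE; apply: (sorted_leq_nth ge_trans) => //; rewrite ?inE.
- by move=> x; exact: lexx.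
- by rewrite size_sort size_tuple.
- by rewrite size_sort size_tuple.
Qed.

(** [partial_svd] gives no ordering; permuting the columns of [U] and [V] along with [s] only
    reindexes the sum of rank one terms. *)
Lemma svd_sort m n k (X : 'M[R]_(m, n)) (U : 'M[R]_(m, k)) (s : 'rV[R]_k)
    (V : 'M[R]_(n, k)) :
    U^T *m U = 1%:M -> V^T *m V = 1%:M -> (forall i, 0 <= s 0 i) ->
    X = U *m diag_mx s *m V^T ->
  exists U' s' V', is_svd (k := k) X U' s' V'.
Proof.
move=> UU VV s0 XE; have [f fs] := sorting_perm s.
have isoP l (W : 'M[R]_(l, k)) : W^T *m W = 1%:M ->
    (\matrix_(i, j) W i (f j))^T *m (\matrix_(i, j) W i (f j)) = 1%:M.
  move=> WW; apply/matrixP => i j; move/matrixP: WW => /(_ (f i) (f j)).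
  rewrite !mxE (inj_eq perm_inj) => <-.
  by apply: eq_bigr => a _; rewrite !mxE.
exists (\matrix_(i, j) U i (f j)), (\row_j s 0 (f j)),
  (\matrix_(i, j) V i (f j)).
split; try exact: isoP.
- by move=> i; rewrite mxE.
- by move=> i j ij; rewrite !mxE fs.
- rewrite XE; apply/matrixP => i j; rewrite !mul_mx_diag !mxE.
  by rewrite (reindex_inj (@perm_inj _ f)); apply: eq_bigr => a _; rewrite !mxE.
Qed.

(** One of [U] and [V] is square, hence orthogonal, so the rest that it annihilates is zero. The
    equation on [k] lets [subst] identify the dimensions. *)
Lemma svd_exists m n k (X : 'M[R]_(m, n)) : k = minn m n ->
  exists (U : 'M[R]_(m, k)) s V, is_svd X U s V.
Proof.
move=> kE.
have km : (k <= m)%N by rewrite kE geq_minl.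
have kn : (k <= n)%N by rewrite kE geq_minr.
have [U [s [V [UU VV s0 UY YV]]]] := partial_svd X km kn.
apply: (svd_sort UU VV s0); apply/eqP; rewrite -subr_eq0; apply/eqP.
move: (X - _) UY YV => Y UY YV.
have [mn|/ltnW nm] := leqP m n.
  have {}kE : k = m by rewrite kE; apply/minn_idPl.
  subst k.
  by rewrite -[Y]mul1mx -(mulmx1C UU) -mulmxA UY mulmx0.
have {}kE : k = n by rewrite kE; apply/minn_idPr.
subst k.
by rewrite -[Y]mulmx1 -(mulmx1C VV) mulmxA YV mul0mx.
Qed.

(** * Best approximation of rank at most [r] *)

(** For a basis $C$ of the row space, $P = C^T (C C^T)^{-1} C$. The Gram matrix is invertible
    because $v C C^T = 0$ forces $|vC|^2 = 0$; cyclicity of the trace yields $\operatorname{tr}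
    P$. *)
Lemma row_space_projector m n (B : 'M[R]_(m, n)) : exists P : 'M[R]_n,
  [/\ P^T = P, P *m P = P, B *m P = B, \tr P = (\rank B)%:R
    & (\rank P <= \rank B)%N].
Proof.
have [C Cfree] : exists2 C : 'M[R]_(\rank B, n), row_free C & (B <= C)%MS.
  by exists (row_base B); rewrite ?row_base_free ?eq_row_base.
case/submxP=> D BE; pose G := C *m C^T.
have GT : G^T = G by rewrite trmx_mul trmxK.
have Gu : G \in unitmx.
  rewrite -row_free_unit; apply/inj_row_free => v vG.
  have vC : v *m C = 0.
    apply/eqP; rewrite -normF_eq0 -normF_tr -sqrf_eq0 normF_sqr /inner trmxK.
    by rewrite trmx_mul -mulmxA (mulmxA C) (mulmxA v) vG mul0mx mxtrace0.
  by apply: (row_free_injr Cfree); rewrite /= vC mul0mx.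
exists (C^T *m invmx G *m C); split.
- by rewrite !trmx_mul trmxK trmx_inv GT mulmxA.
- by rewrite !mulmxA -(mulmxA _ C) mulmxKV.
- have CP : C *m (C^T *m invmx G *m C) = C by rewrite !mulmxA mulmxV // mul1mx.
  by transitivity (D *m C *m (C^T *m invmx G *m C));
    [congr (_ *m _) | rewrite -mulmxA CP].
- by rewrite mxtrace_mulC mulmxA mulmxV // mxtrace1.
- by rewrite -mulmxA; apply: leq_trans (mulmx_max_rank _ _) _.
Qed.

Lemma svd_normF_sqr m n k (U : 'M[R]_(m, k)) (s : 'rV[R]_k) (V : 'M[R]_(n, k)) :
    U^T *m U = 1%:M -> V^T *m V = 1%:M ->
  normF (U *m diag_mx s *m V^T) ^+ 2 = \sum_i s 0 i ^+ 2.
Proof.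
move=> UU VV; rewrite normF_mul_isometry_tr // normF_isometry_mul //.
rewrite normF_sqr_sum; apply: eq_bigr => i _; rewrite (bigD1 i) //= !mxE eqxx.
rewrite big1 ?addr0 ?mulr1n // => j ji; rewrite !mxE eq_sym (negbTE ji).
by rewrite mulr0n expr0n.
Qed.

Lemma sum_ord_lt k r : (r <= k)%N -> \sum_(i < k) ((i < r)%N)%:R = r%:R :> R.
Proof.
move=> rk; rewrite -natr_sum -big_mkcond /=.
by rewrite -(big_ord_widen _ (fun=> 1%N)) // sum1_card card_ord.
Qed.

Lemma hard_threshold_error m n r (U : 'M[R]_(m, minn m n)) s
    (V : 'M[R]_(n, minn m n)) (Z : 'M[R]_(m, n)) :
    is_svd Z U s V ->
  normF (Z - U *m diag_mx (\row_i (if (i < r)%N then s 0 i else 0)) *m V^T) ^+ 2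
    = \sum_(i < minn m n) (if (i < r)%N then 0 else s 0 i ^+ 2).
Proof.
case=> UU VV _ _ ->; rewrite -mulmxBl -mulmxBr -linearB /= svd_normF_sqr //.
apply: eq_bigr => i _; rewrite !mxE.
by case: ifP => _; rewrite ?subrr ?expr0n ?subr0.
Qed.

(* Only [Z *m P] can be approximated by [B], where [P] projects onto the row
   space of [B]; its squared norm is an average of the squared singular values
   of [Z] with weights in [0, 1] of total mass at most [r]. *)
Theorem hard_threshold_best m n r (Z H B : 'M[R]_(m, n)) :
  (r < minn m n)%N -> hard_threshold r Z H -> (\rank B <= r)%N ->
  normF (Z - H) <= normF (Z - B).
Proof.
move=> rk [U [s [V [svdZ ->]]]] rB.
rewrite ler_normF_sqr (hard_threshold_error r svdZ).
case: svdZ => UU VV s0 s_sort ZE.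
have [P [PT PP BP trP rP]] := row_space_projector B.
have le1 : normF (Z *m (1%:M - P)) ^+ 2 <= normF (Z - B) ^+ 2.
  rewrite (normF_mul_proj (Z - B) PT PP) (mulmxBl Z B (1%:M - P)).
  by rewrite (mulmxBr B) mulmx1 BP subrr subr0 lerDr sqr_ge0.
apply: le_trans le1; have := normF_mul_proj Z PT PP.
pose w i := normF (row i (V^T *m P)) ^+ 2.
have ->: normF (Z *m P) ^+ 2 = \sum_i s 0 i ^+ 2 * w i.
  rewrite ZE -!mulmxA normF_isometry_mul // normF_sqr_sum.
  apply: eq_bigr => i _; rewrite /w normF_sqr_sum big_ord1 mulr_sumr.
  by apply: eq_bigr => j _; rewrite mul_diag_mx !mxE exprMn.
have ->: normF Z ^+ 2 = \sum_i s 0 i ^+ 2 by rewrite ZE svd_normF_sqr.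
have w1 i : w i <= 1.
  have {1}->: (1 : R) = normF (row i V^T) ^+ 2.
    rewrite normF_sqr innerE big_ord1.
    move/matrixP: VV => /(_ i i); rewrite !mxE eqxx mulr1n => <-.
    by apply: eq_bigr => j _; rewrite !mxE.
  by rewrite /w row_mul (normF_mul_proj (row i V^T) PT PP) lerDl sqr_ge0.
have w0 i : 0 <= w i by exact: sqr_ge0.
(* $\sum_i w_i = |V^T P|^2 \le |P|^2 = \operatorname{tr} P = \operatorname{rank} B$. *)
have sw : \sum_i w i <= r%:R.
  have ->: \sum_i w i = normF (V^T *m P) ^+ 2.
    rewrite normF_sqr_sum; apply: eq_bigr => i _.
    by rewrite /w normF_sqr_sum big_ord1; apply: eq_bigr => j _; rewrite mxE.
  apply: (@le_trans _ _ (normF P ^+ 2)); last first.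
    by rewrite normF_sqr /inner PT PP trP ler_nat.
  rewrite -ler_normF_sqr -normF_tr trmx_mul trmxK PT.
  exact: normF_mul_isometry_le.
(* Indices start at 0, so [c] is the first discarded squared singular value. Termwise, [key] is
   $(s_i^2 - c)(1 - w_i) \ge 0$ for $i < r$ and $s_i^2 w_i \le c w_i$ otherwise; after summation the
   terms in [c] give $c(\sum_i w_i - r) \le 0$. *)
pose c := s 0 (Ordinal rk) ^+ 2.
have key : \sum_i s 0 i ^+ 2 * w i <=
    \sum_(i < minn m n) (((if (i < r)%N then s 0 i ^+ 2 else 0) + c * w i)
                          - c * ((i < r)%N)%:R).
  apply: ler_sum => i _; have := w0 i; have := w1 i.
  have mono (a b : 'I_(minn m n)) : (a <= b)%N -> s 0 b ^+ 2 <= s 0 a ^+ 2.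
    by move=> ab; rewrite ler_sqr ?nnegrE ?s0 ?s_sort.
  case: ifP => [ir|/negbT]; rewrite ?mulr1 ?mulr0.
    have h : 0 <= s 0 i ^+ 2 - c by rewrite subr_ge0 mono // ltnW.
    move=> w1i _; have h1 : 0 <= 1 - w i by rewrite subr_ge0.
    have := mulr_ge0 h h1; clear h h1.
    by move: (w i) (s 0 i ^+ 2) c => a b d; lra.
  rewrite -leqNgt => ri; have h : s 0 i ^+ 2 <= c by apply: mono.
  by move=> _ w0i; rewrite add0r subr0 ler_wpM2r.
move: key; rewrite sumrB big_split /=.
rewrite -[X in _ + X - _]mulr_sumr -[X in _ - X]mulr_sumr.
rewrite (sum_ord_lt (ltnW rk)).
have c0 : 0 <= c by exact: sqr_ge0.
have := ler_wpM2l c0 sw.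
have -> : \sum_i s 0 i ^+ 2 =
    \sum_(i < minn m n) (if (i < r)%N then s 0 i ^+ 2 else 0)
    + \sum_(i < minn m n) (if (i < r)%N then 0 else s 0 i ^+ 2).
  rewrite -big_split /=.
  by apply: eq_bigr => i _; case: ifP; rewrite ?addr0 ?add0r.
move=> h1 h2 h3; lra.
Qed.

(** * Smallest and largest singular values *)

Lemma singular_value_ge0 m n (Z : 'M[R]_(m, n)) t :
  singular_value Z t -> 0 <= t.
Proof. by case=> U [s [V [[_ _ s0 _ _] [i ->]]]]. Qed.

Lemma singular_value_le_normF m n (Z : 'M[R]_(m, n)) t :
  singular_value Z t -> t <= normF Z.
Proof.
case=> U [s [V [[UU VV s0 _ ->] [i ->]]]].
rewrite -ler_sqr ?nnegrE ?normF_ge0 // svd_normF_sqr // (bigD1 i) //= lerDl.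
by apply: sumr_ge0 => j _; exact: sqr_ge0.
Qed.

(** A column $v$ of [V'] is an eigenvector of $Z^T Z = V \operatorname{diag}(s)^2 V^T$ for $t^2$; a
    coordinate $j$ with $(V^T v)_j \ne 0$ forces $s_j^2 = t^2$. *)
Lemma singular_value_eq m n (Z : 'M[R]_(m, n)) (U : 'M[R]_(m, minn m n)) s
    (V : 'M[R]_(n, minn m n)) t :
  is_svd Z U s V -> singular_value Z t -> t != 0 -> exists i, t = s 0 i.
Proof.
move=> [UU VV s0 _ ZE] [U' [s' [V' [[U'U' V'V' s'0 _ ZE'] [i tE]]]]] t0.
have gram k (W : 'M[R]_(m, k)) d (W' : 'M[R]_(n, k)) : W^T *m W = 1%:M ->
    (W *m diag_mx d *m W'^T)^T *m (W *m diag_mx d *m W'^T) =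
    W' *m diag_mx d *m diag_mx d *m W'^T.
  move=> WW; rewrite !trmx_mul trmxK tr_diag_mx !mulmxA.
  by rewrite -(mulmxA _ W^T) WW mulmx1.
pose e : 'cV[R]_(minn m n) := delta_mx i 0; pose v := V' *m e.
have V'v : V'^T *m v = e by rewrite mulmxA V'V' mul1mx.
have s'e : diag_mx s' *m e = t *: e.
  apply/colP => a; rewrite mul_diag_mx !mxE tE.
  by case: eqP => [->|] //; rewrite !mulr0.
have eig : Z^T *m Z *m v = t ^+ 2 *: v.
  by rewrite ZE' gram // -!mulmxA V'v s'e -!scalemxAr s'e -scalemxAr scalerA.
(* Otherwise $t^2 v = Z^T Z v = 0$, against $t \ne 0$. *)
have Vv0 : V^T *m v != 0.
  apply: contra_neq t0 => Vv; apply/eqP; rewrite -sqrf_eq0; apply/eqP.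
  move: eig; rewrite ZE gram // -mulmxA Vv mulmx0 => /(congr1 (mulmx V'^T)).
  rewrite mulmx0 -scalemxAr V'v => /matrixP/(_ i 0).
  by rewrite !mxE !eqxx mulr1.
have /cV0Pn[j Vvj] := Vv0.
exists j; apply/eqP; rewrite -(eqrXn2 (ltn0Sn 1)) //; last by rewrite tE.
move: eig; rewrite ZE gram // => /(congr1 (mulmx V^T)).
rewrite !mulmxA VV mul1mx -!mulmxA -scalemxAr; move: (V^T *m v) Vvj => Q Qja.
move=> /matrixP/(_ j 0); rewrite !mul_diag_mx !mxE mulrA -expr2.
by move/(mulIf Qja) => ->.
Qed.

Lemma sigma_min_le m n (Z : 'M[R]_(m, n)) t :
  singular_value Z t -> t != 0 -> sigma_min Z <= t.
Proof.
move=> Zt t0; apply: ge_inf => //.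
by exists 0 => u [/singular_value_ge0].
Qed.

Lemma le_sigma_max m n (Z : 'M[R]_(m, n)) t :
  singular_value Z t -> t <= sigma_max Z.
Proof.
move=> Zt; apply: ub_le_sup => //.
by exists (normF Z) => u /singular_value_le_normF.
Qed.

Lemma singular_value_neq0_exists m n (Z : 'M[R]_(m, n)) :
  Z != 0 -> exists2 t, singular_value Z t & t != 0.
Proof.
move=> Z0; have [U [s [V svdZ]]] := svd_exists Z erefl.
suff [i si0] : exists i, s 0 i != 0.
  by exists (s 0 i) => //; exists U, s, V; split=> //; exists i.
apply/existsP; apply: contraNT Z0; rewrite negb_exists => /forallP s0.
case: svdZ => UU VV _ _ ->; rewrite -normF_eq0 -sqrf_eq0 svd_normF_sqr //.
by rewrite big1 // => i _; move: (s0 i); rewrite negbK => /eqP ->;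
  rewrite expr0n.
Qed.

Lemma sigma_min_gt0 m n (Z : 'M[R]_(m, n)) : Z != 0 -> 0 < sigma_min Z.
Proof.
move=> Z0; have [U [s [V svdZ]]] := svd_exists Z erefl.
(* $1/c$ is a positive lower bound for the nonzero singular values: each $1/s_i$ is at most [c], and
   a zero $s_i$ contributes 0 since $0^{-1} = 0$. *)
have [_ _ s0 _ _] := svdZ; pose c := 1 + \sum_i (s 0 i)^-1.
have sum0 : 0 <= \sum_i (s 0 i)^-1 by apply: sumr_ge0 => i _; rewrite invr_ge0.
have c0 : 0 < c by rewrite ltr_pwDl.
apply: (@lt_le_trans _ _ c^-1); first by rewrite invr_gt0.
apply: lb_le_inf.
  by have [t Zt t0] := singular_value_neq0_exists Z0; exists t.
move=> t [Zt t0]; have [i tE] := singular_value_eq svdZ Zt t0.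
have tp : 0 < t by rewrite lt_def t0 (singular_value_ge0 Zt).
rewrite -[t]invrK lef_pV2 ?posrE ?invr_gt0 // tE /c (bigD1 i) //=.
rewrite addrCA lerDl addr_ge0 //.
by apply: sumr_ge0 => j _; rewrite invr_ge0.
Qed.

(** [Z] approximates itself, so thresholding makes no error and the singular values after the first
    [r] vanish; [r] squares remain, each at most $\sigma_{\max}^2$. *)
Lemma normF_le_sigma_max m n r (Z : 'M[R]_(m, n)) :
    (r < minn m n)%N -> (\rank Z <= r)%N ->
  normF Z <= Num.sqrt r%:R * sigma_max Z.
Proof.
move=> rk rZ; have [U [s [V svdZ]]] := svd_exists Z erefl.
have smax i : s 0 i <= sigma_max Z.
  by apply: le_sigma_max; exists U, s, V; split=> //; exists i.
have [UU VV s0 _ ZE] := svdZ.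
have max0 : 0 <= sigma_max Z by apply: le_trans (smax (Ordinal rk)).
pose H := U *m diag_mx (\row_i (if (i < r)%N then s 0 i else 0)) *m V^T.
have thr : hard_threshold r Z H by exists U, s, V.
have := hard_threshold_best rk thr rZ.
rewrite ler_normF_sqr (hard_threshold_error r svdZ) subrr.
rewrite normF_sqr inner0r => tail.
rewrite -ler_sqr ?nnegrE ?mulr_ge0 ?sqrtr_ge0 ?normF_ge0 //.
rewrite exprMn (sqr_sqrtr (ler0n _ _)) {1}ZE svd_normF_sqr //.
rewrite -(sum_ord_lt (ltnW rk)) mulr_suml -[leRHS]addr0.
apply: le_trans (lerD (lexx _) tail); rewrite -big_split /=.
apply: ler_sum => i _; case: ifP => _; rewrite ?mul1r ?mul0r ?addr0 ?add0r //.
by rewrite ler_sqr ?nnegrE.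
Qed.

(** * Distance to the tangent space *)

Lemma normF_coproj_mul_le m n k (U : 'M[R]_(m, k)) (Z : 'M[R]_(m, n)) :
  U^T *m U = 1%:M -> normF ((1%:M - U *m U^T) *m Z) <= normF Z.
Proof.
move=> UU; rewrite -normF_tr -(normF_tr Z) trmx_mul linearB /= trmx1.
by rewrite trmx_mul trmxK normF_mul_coproj_le.
Qed.

Lemma normF_isometry_tr_mul_le m n k (U : 'M[R]_(m, k)) (Z : 'M[R]_(m, n)) :
  U^T *m U = 1%:M -> normF (U^T *m Z) <= normF Z.
Proof.
move=> UU; rewrite -normF_tr -(normF_tr Z) trmx_mul trmxK.
exact: normF_mul_isometry_le.
Qed.

Lemma proj_tangent_compl m n r (U : 'M[R]_(m, r)) (V : 'M[R]_(n, r)) Z :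
  Z - proj_tangent U V Z = (1%:M - U *m U^T) *m Z *m (1%:M - V *m V^T).
Proof.
rewrite /proj_tangent mulmxBr mulmx1 !mulmxBl !mul1mx !mulmxA.
by rewrite -addrA opprD addrA.
Qed.

Lemma coproj_svd m n r (Y : 'M[R]_(m, n)) (U : 'M[R]_(m, r)) s
    (V : 'M[R]_(n, r)) :
    is_svd Y U s V ->
  (1%:M - U *m U^T) *m Y = 0 /\ Y *m (1%:M - V *m V^T) = 0.
Proof.
case=> UU VV _ _ ->; split.
  by rewrite mulmxBl mul1mx !mulmxA -(mulmxA U U^T) UU mulmx1 subrr.
by rewrite mulmxBr mulmx1 !mulmxA -(mulmxA _ V^T) VV mulmx1 subrr.
Qed.

(** As $(I - UU^T)Y = 0$, the error is $-(I - UU^T) X (I - VV^T)$. *)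
Lemma rank_tangent_error m n r (X Y : 'M[R]_(m, n)) (U : 'M[R]_(m, r)) s
    (V : 'M[R]_(n, r)) :
    is_svd Y U s V ->
  (\rank ((Y - X) - proj_tangent U V (Y - X))%R <= \rank X)%N.
Proof.
move=> /coproj_svd[PUY _]; rewrite proj_tangent_compl [_ *m (Y - X)]mulmxBr PUY.
rewrite sub0r mulNmx.
rewrite mxrank_opp -mulmxA; apply: leq_trans (mxrankM_maxr _ _) _.
exact: mxrankM_maxl.
Qed.

(* [K] is the pseudo-inverse of [X]: inserting [X = X *m K *m X] between the
   two projections makes the error quadratic in [Y - X]. *)
Lemma tangent_error m n r (X Y : 'M[R]_(m, n)) (U : 'M[R]_(m, r)) s
    (V : 'M[R]_(n, r)) :
    X != 0 -> is_svd Y U s V ->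
  normF ((Y - X) - proj_tangent U V (Y - X)) <=
    normF (Y - X) ^+ 2 / sigma_min X.
Proof.
move=> X0 svdY; have [UU VV _ _ _] := svdY; have [PUY YPV] := coproj_svd svdY.
set T := Y - X; rewrite proj_tangent_compl.
set PU := 1%:M - U *m _ in PUY *; set PV := 1%:M - V *m _ in YPV *.
have PUT : PU *m T = - (PU *m X) by rewrite mulmxBr PUY sub0r.
have TPV : T *m PV = - (X *m PV) by rewrite mulmxBl YPV sub0r.
have [U1 [s1 [V1 svdX]]] := svd_exists X erefl.
have [UU1 VV1 s10 _ XE] := svdX.
(* Since $0^{-1} = 0$, zero singular values stay zero and [V1 *m diag_mx d *m U1^T] is the
   Moore-Penrose inverse. *)
pose d := map_mx GRing.inv s1.
have XKX : X = X *m (V1 *m diag_mx d *m U1^T) *m X.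
  rewrite [in RHS]XE !mulmxA -(mulmxA _ V1^T V1) VV1 mulmx1.
  rewrite -(mulmxA _ U1^T U1) UU1 mulmx1 -(mulmxA U1) -(mulmxA U1).
  rewrite {1}XE; congr (_ *m _ *m _); apply/matrixP => i j.
  rewrite !mul_mx_diag !mxE; case: eqP => [->|_]; last by rewrite mulr0n !mul0r.
  rewrite mulr1n; have [->|h] := eqVneq (s1 0 j) 0; first by rewrite !mulr0.
  by rewrite divff // mul1r.
(* [PUT] and [TPV] turn the two copies of [X] around the pseudo-inverse into [T], at the cost of
   signs. *)
have -> : PU *m T *m PV =
    - ((PU *m T *m V1) *m diag_mx d *m (U1^T *m (T *m PV))).
  rewrite PUT TPV mulNmx {1}XKX !mulmxN !mulNmx !mulmxA opprK //.
have smin := sigma_min_gt0 X0.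
have dle i : `|d 0 i| <= (sigma_min X)^-1.
  rewrite mxE ger0_norm ?invr_ge0 //.
  have [->|si0] := eqVneq (s1 0 i) 0; first by rewrite invr0 invr_ge0 ltW.
  rewrite lef_pV2 ?posrE //; last by rewrite lt_def si0 s10.
  by apply: sigma_min_le => //; exists U1, s1, V1; split=> //; exists i.
rewrite normFN mulrC; apply: le_trans (normFM _ _) _.
rewrite expr2 mulrA; apply: ler_pM; rewrite ?normF_ge0 //.
  apply: le_trans (normF_mul_diag_le _ _ dle) _; first by rewrite invr_ge0 ltW.
  apply: ler_wpM2l; first by rewrite invr_ge0 ltW.
  apply: le_trans (normF_mul_isometry_le _ VV1) _.
  exact: normF_coproj_mul_le.
apply: le_trans (normF_isometry_tr_mul_le _ UU1) _.
exact: normF_mul_coproj_le.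
Qed.

(** * Restricted isometry and the initial error *)

Lemma ric_ge0 m n p (A : {linear 'M[R]_(m, n) -> 'cV[R]_p}) k :
  (0 < m)%N -> (0 < n)%N -> (0 < k)%N -> 0 <= ric A k.
Proof.
move=> m0 n0 k0; have [H _] := ric_least A m0 n0 k0.
set D : 'M[R]_(m, n) := delta_mx (Ordinal m0) (Ordinal n0).
have rD : (\rank D <= k)%N by rewrite mxrank_delta.
have /andP[h1 h2] := H D rD.
have D0 : 0 < normF D ^+ 2.
  rewrite exprn_gt0 // lt_def normF_ge0 andbT normF_eq0.
  apply/eqP => /matrixP/(_ (Ordinal m0) (Ordinal n0)).
  by rewrite !mxE !eqxx => /eqP; rewrite oner_eq0.
by have := le_trans h1 h2; rewrite ler_pM2r // => h; lra.
Qed.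

Lemma rip_inner m n p (A : {linear 'M[R]_(m, n) -> 'cV[R]_p}) k d
    (Y Z : 'M[R]_(m, n)) :
    rip_bound A k d -> (forall b c, \rank (b *: Y + c *: Z)%R <= k)%N ->
  `|inner Y Z - inner (A Y) (A Z)| <= d * (normF Y * normF Z).
Proof.
move=> H rk; rewrite -[inner (A Y) _]mul1r; apply: polarization_bound => b c /=.
set W := _ *: Y + _.
have /andP[h1 h2] := H W (rk b c).
by rewrite mul1r ler_norml; apply/andP; split; lra.
Qed.

(* [X0] remains the better approximation after projecting
   [Z := A^* (A X)] onto the joint row space of [X] and [X0], where only
   matrices of rank at most [2 * r] occur. *)
Lemma initial_error m n p r (A : {linear 'M[R]_(m, n) -> 'cV[R]_p}) d
    (X X0 : 'M[R]_(m, n)) :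
    (r < minn m n)%N -> 0 <= d -> rip_bound A (2 * r) d ->
    (\rank X <= r)%N -> (\rank X0 <= r)%N ->
    hard_threshold r (adjoint A (A X)) X0 ->
  normF (X0 - X) <= 2 * d * normF X.
Proof.
move=> rk d0 H rX rX0; set Z := adjoint A (A X) => thr.
have best := hard_threshold_best rk thr rX.
have [P [PT PP BP _ rP]] := row_space_projector (col_mx X X0).
have {BP} [XP X0P] : X *m P = X /\ X0 *m P = X0.
  by apply: eq_col_mx; rewrite -mul_col_mx.
have {}rP : (\rank P <= 2 * r)%N.
  apply: leq_trans rP _; rewrite -addsmxE.
  rewrite (leq_trans (mxrank_adds_leqif _ _)) //.
  by rewrite mul2n -addnn leq_add.
(* The term $Z(I - P)$ is common to the errors of [X] and [X0], so it cancels in their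
   comparison. *)
have pyth B : B *m P = B ->
    normF (Z - B) ^+ 2 = normF (Z *m P - B) ^+ 2 + normF (Z *m (1%:M - P)) ^+ 2.
  move=> BP; have BQ : B *m (1%:M - P) = 0 by rewrite mulmxBr mulmx1 BP subrr.
  by rewrite (normF_mul_proj (Z - B) PT PP) !(mulmxBl Z B) BP BQ subr0.
have {}best : normF (Z *m P - X0) <= normF (Z *m P - X).
  by move: best; rewrite !ler_normF_sqr (pyth X) // (pyth X0) // lerD2r.
set D := X - Z *m P.
have DX : normF (Z *m P - X) = normF D by rewrite -normFN opprB.
have DP : D *m P = D by rewrite mulmxBl -mulmxA PP XP.
have Dle : normF D <= d * normF X.
  have [D0|D0] := eqVneq (normF D) 0; first by rewrite D0 mulr_ge0 ?normF_ge0.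
  have Dp : 0 < normF D by rewrite lt_def D0 normF_ge0.
  rewrite -(ler_pM2l Dp) -expr2 normF_sqr.
  (* $\langle D, ZP\rangle = \langle D, Z\rangle = \langle AD, AX\rangle$, because $DP = D$. *)
  have -> : inner D D = inner D X - inner (A D) (A X).
    rewrite inner_adjoint -/Z -innerBr -{3}DP inner_mulr PT mulmxBl XP //.
  apply: le_trans (ler_norm _) _; rewrite mulrCA; apply: (rip_inner H) => b c.
  rewrite -DP -{1}XP !scalemxAl -mulmxDl.
  exact: leq_trans (mxrankM_maxr _ _) rP.
have -> : X0 - X = - (Z *m P - X0) + (Z *m P - X) by rewrite opprB subrKA.
apply: le_trans (normFD _ _) _; rewrite normFN -mulrA.
move: best Dle; rewrite DX; lra.
Qed.

(** * One step of the descent *)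

Lemma tangent_space_lin m n r (U : 'M[R]_(m, r)) (V : 'M[R]_(n, r)) b c Y Z :
  tangent_space U V Y -> tangent_space U V Z ->
  tangent_space U V (b *: Y + c *: Z).
Proof.
move=> [L [M ->]] [L' [M' ->]]; exists (b *: L + c *: L'), (b *: M + c *: M').
have -> : (b *: M + c *: M')^T = b *: M^T + c *: M'^T.
  by rewrite linearD !linearZ.
by rewrite mulmxDr mulmxDl -!scalemxAr -!scalemxAl addrACA !scalerDr.
Qed.

Lemma rank_tangent_space m n r (U : 'M[R]_(m, r)) (V : 'M[R]_(n, r)) Z :
  tangent_space U V Z -> (\rank Z <= 2 * r)%N.
Proof.
move=> [L [M ->]]; rewrite (leq_trans (mxrank_add _ _)) // mul2n -addnn.
by rewrite leq_add // mulmx_max_rank.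
Qed.

Lemma inner_proj_tangent m n r (U : 'M[R]_(m, r)) (V : 'M[R]_(n, r)) Y Z :
    U^T *m U = 1%:M -> V^T *m V = 1%:M -> tangent_space U V Y ->
  inner Y (proj_tangent U V Z) = inner Y Z.
Proof.
move=> UU VV SY; have [_ /(_ Y SY)] := proj_tangentP Z UU VV.
by rewrite innerBr => /eqP; rewrite subr_eq0 => /eqP.
Qed.

Lemma proj_tangent_pythagoras m n r (U : 'M[R]_(m, r)) (V : 'M[R]_(n, r)) Z :
    U^T *m U = 1%:M -> V^T *m V = 1%:M ->
  normF Z ^+ 2 = normF (proj_tangent U V Z) ^+ 2 +
                 normF (Z - proj_tangent U V Z) ^+ 2.
Proof.
move=> UU VV; have [SP /(_ _ SP) ort] := proj_tangentP Z UU VV.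
have ZE : Z = proj_tangent U V Z + (Z - proj_tangent U V Z) by rewrite subrKC.
by rewrite {1}ZE normF_sqrD ort mulr0 addr0.
Qed.

(* On rank [k] matrices the quadratic form [|Z|^2 - a |A Z|^2] lies between
   [1 - a (1 + d)] and [1 - a (1 - d)] times [|Z|^2]. *)
Lemma rip_step_bound m n p (A : {linear 'M[R]_(m, n) -> 'cV[R]_p}) k d a
    (Y Z : 'M[R]_(m, n)) :
    rip_bound A k d -> 0 <= d < 1 -> (1 + d)^-1 <= a <= (1 - d)^-1 ->
    (forall b c, \rank (b *: Y + c *: Z)%R <= k)%N ->
  `|inner Y Z - a * inner (A Y) (A Z)| <= 2 * d / (1 - d) * (normF Y * normF Z).
Proof.
move=> H /andP[d0 d1] /andP[a1 a2] rk; apply: polarization_bound => b c /=.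
set W := _ *: Y + _.
have /andP[h1 h2] := H W (rk b c).
have d1' : 0 < 1 - d by rewrite subr_gt0.
have d2' : 0 < 1 + d by rewrite ltr_pwDl.
have a0 : 0 <= a by apply: le_trans a1; rewrite invr_ge0 ltW.
have N0 : 0 <= normF W ^+ 2 by exact: sqr_ge0.
(* The extreme values are $(1+d)/(1-d) = 1 + 2d/(1-d)$ and $(1-d)/(1+d) = 1 - 2d/(1+d)$; the first
   deviates more from 1. *)
have k1 : a * (1 + d) <= 1 + 2 * d / (1 - d).
  have -> : 1 + 2 * d / (1 - d) = (1 - d)^-1 * (1 + d).
    by field; rewrite gt_eqF.
  by rewrite ler_wpM2r // ltW.
have k2 : 1 - 2 * d / (1 - d) <= a * (1 - d).
  apply: (@le_trans _ _ ((1 + d)^-1 * (1 - d))); last first.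
    by rewrite ler_wpM2r // ltW.
  rewrite -subr_ge0.
  have -> : (1 + d)^-1 * (1 - d) - (1 - 2 * d / (1 - d)) =
      (2 * d) * (2 * d) / ((1 - d) * (1 + d)).
    by field; rewrite !gt_eqF.
  by rewrite divr_ge0 ?mulr_ge0 // ltW.
have m1 := ler_wpM2l a0 h1; have m2 := ler_wpM2l a0 h2.
have m3 := ler_wpM2r N0 k1; have m4 := ler_wpM2r N0 k2.
by rewrite ler_norml; apply/andP; split; lra.
Qed.

(** The factor still contains the current error, which the final induction bounds by the initial
    one. *)
Lemma step_error m n p r (A : {linear 'M[R]_(m, n) -> 'cV[R]_p}) d2 d3
    (X Y Y' : 'M[R]_(m, n)) :
    (r < minn m n)%N -> 0 <= d2 < 1 -> 0 <= d3 ->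
    rip_bound A (2 * r) d2 -> rip_bound A (3 * r) d3 ->
    X != 0 -> (\rank X <= r)%N -> rgd_step r A (A X) Y Y' ->
  normF (Y' - X) <= ((4 * d2 + 2 * d3) / (1 - d2) +
    2 * normF (Y - X) / sigma_min X) * normF (Y - X).
Proof.
move=> rk d2b d30 H2 H3 X0 rX [U [s [V [svdY thr]]]].
have /andP[d20 d21] := d2b.
have [UU VV _ _ YE] := svdY.
set T := Y - X; pose D := proj_tangent U V T; pose N := T - D.
pose Pg := proj_tangent U V (adjoint A (A X - A Y)).
have SP Z : tangent_space U V (proj_tangent U V Z).
  by case: (proj_tangentP Z UU VV).
have orthN Q : tangent_space U V Q -> inner Q N = 0.
  by case: (proj_tangentP T UU VV) => _; apply.
have innerPg Q : tangent_space U V Q -> inner Q Pg = - inner (A Q) (A T).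
  move=> SQ; rewrite inner_proj_tangent // -inner_adjoint -innerNr.
  by rewrite /T linearB opprB.
have d2' : 0 < 1 - d2 by rewrite subr_gt0.
have d2'' : 0 < 1 + d2 by rewrite ltr_pwDl.
(* Only the product [a *: Pg] matters. If [Pg] is zero, the step size $0/0 = 0$ lies outside this
   range and 1 replaces it; otherwise restricted isometry at [Pg] gives the range. *)
have [a /andP[a1 a2] aE] : exists2 a, (1 + d2)^-1 <= a <= (1 - d2)^-1 &
    a *: Pg = (normF Pg ^+ 2 / normF (A Pg) ^+ 2) *: Pg.
  have [Pg0|Pg0] := eqVneq Pg 0.
    exists 1; last by rewrite Pg0 !scaler0.
    by rewrite invf_le1 // invf_ge1 //; apply/andP; split; lra.
  exists (normF Pg ^+ 2 / normF (A Pg) ^+ 2) => //.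
  have /andP[h1 h2] := H2 Pg (rank_tangent_space (SP _)).
  have Pgp : 0 < normF Pg ^+ 2.
    by rewrite exprn_gt0 // lt_def normF_eq0 Pg0 normF_ge0.
  have APgp : 0 < normF (A Pg) ^+ 2 by apply: lt_le_trans h1; rewrite mulr_gt0.
  rewrite ler_pdivlMr // mulrC ler_pdivrMr // mulrC h2 /=.
  by rewrite ler_pdivrMr // mulrC ler_pdivlMr // mulrC.
pose E := D + a *: Pg.
have SE b c : tangent_space U V (b *: E + c *: D).
  apply: tangent_space_lin; last exact: SP.
  by rewrite /E -[D]scale1r; apply: tangent_space_lin; exact: SP.
have SEE : tangent_space U V E.
  by have := SE 1 0; rewrite scale1r scale0r addr0.
have a0 : 0 <= a by apply: le_trans a1; rewrite invr_ge0 ltW.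
have bound1 : `|inner E D - a * inner (A E) (A D)| <=
    2 * d2 / (1 - d2) * (normF E * normF D).
  apply: (rip_step_bound H2 d2b); first exact/andP.
  by move=> b c; exact: rank_tangent_space (SE b c).
have bound2 : `|inner E N - inner (A E) (A N)| <= d3 * (normF E * normF N).
  apply: (rip_inner H3) => b c; apply: leq_trans (mxrank_add _ _) _.
  have -> : (3 * r = 2 * r + r)%N by rewrite mulSn addnC.
  apply: leq_add.
    exact: leq_trans (mxrank_scale _ _) (rank_tangent_space SEE).
  apply: leq_trans (mxrank_scale _ _) _.
  exact: leq_trans (rank_tangent_error X svdY) rX.
(* $\langle E, P_g\rangle = -\langle AE, AD + AN\rangle$, and $\langle E, N\rangle = 0$ is inserted
   so that [bound2] applies. *)
have EE : normF E ^+ 2 = inner E D - a * inner (A E) (A D) +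
    a * (inner E N - inner (A E) (A N)).
  have ED : inner E E = inner E D + a * inner E Pg by rewrite -innerZr -innerDr.
  have AT : A T = A D + A N by rewrite -linearD /N subrKC.
  rewrite normF_sqr ED innerPg // orthN // AT (innerDr (A E)).
  by move: (inner E D) (inner (A E) _) (inner (A E) _) => x y z; ring.
set e := normF E in bound1 bound2 EE; set t := normF T.
have Dt : normF D <= t.
  by rewrite ler_normF_sqr (proj_tangent_pythagoras T UU VV) lerDl sqr_ge0.
have Nt : normF N <= t.
  by rewrite ler_normF_sqr (proj_tangent_pythagoras T UU VV) lerDr sqr_ge0.
have Nt2 : normF N <= t ^+ 2 / sigma_min X by exact: tangent_error X0 svdY.
have t0 : 0 <= t by exact: normF_ge0.
(* For $e \ne 0$, [EE] is divided by [e]; the denominator under [d3] comes from $a \le 1/(1 -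
   d_2)$. *)
have Ele : e <= (2 * d2 + d3) / (1 - d2) * t.
  have k0 : 0 <= (2 * d2 + d3) / (1 - d2).
    by apply: divr_ge0; [lra | exact: ltW].
  have [e0|e0] := eqVneq e 0; first by rewrite e0 mulr_ge0.
  have ep : 0 < e by rewrite lt_def e0 normF_ge0.
  rewrite -(ler_pM2l ep) -expr2 EE mulrDl.
  have -> : e * ((2 * d2 / (1 - d2) + d3 / (1 - d2)) * t) =
    2 * d2 / (1 - d2) * (e * t) + (1 - d2)^-1 * (d3 * (e * t)) by ring.
  apply: lerD.
    apply: le_trans (ler_norm _) (le_trans bound1 _).
    by rewrite ler_wpM2l ?ler_wpM2l ?divr_ge0 ?mulr_ge0 // ltW.
  apply: le_trans (ler_wpM2l a0 (le_trans (ler_norm _) bound2)) _.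
  apply: ler_pM => //; first by rewrite !mulr_ge0 ?normF_ge0.
  by rewrite ler_wpM2l ?ler_wpM2l // ltW.
pose W := Y + a *: Pg.
have WX : W - X = E + N.
  by rewrite /W addrAC -/T /E /N [RHS]addrAC subrKC.
have best : normF (W - Y') <= normF (W - X).
  by apply: (hard_threshold_best rk) rX; rewrite /W aE.
have -> : Y' - X = - (W - Y') + (W - X) by rewrite opprB subrKA.
apply: le_trans (normFD _ _) _; rewrite normFN.
have := normFD E N; rewrite -WX -/e => tri.
have -> : ((4 * d2 + 2 * d3) / (1 - d2) + 2 * t / sigma_min X) * t =
  2 * ((2 * d2 + d3) / (1 - d2) * t) + 2 * (t ^+ 2 / sigma_min X) by ring.
lra.
Qed.

(** * Contraction along the iterates and the sufficient condition *)

Lemma ric_le m n p (A : {linear 'M[R]_(m, n) -> 'cV[R]_p}) k l :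
  (0 < m)%N -> (0 < n)%N -> (0 < k)%N -> (k <= l)%N -> ric A k <= ric A l.
Proof.
move=> m0 n0 k0 kl; have [_] := ric_least A m0 n0 k0; apply => Z rZ.
have [H _] := ric_least A m0 n0 (leq_trans k0 kl).
exact: H (leq_trans rZ kl).
Qed.

End RiemannianGradientDescent.

Theorem theorem2p1 (R : realType) (m n p r : nat)
  (m_gt0 : (0 < m)%N) (n_gt0 : (0 < n)%N) (p_gt0 : (0 < p)%N)
  (r_gt0 : (0 < r)%N) (p_lt : (p < m * n)%N)
  (r_lt : (r < minn m n)%N) (r3_le : (3 * r <= minn m n)%N)
  (A : {linear 'M[R]_(m, n) -> 'cV[R]_p})
  (ric2_lt1 : ric A (2 * r)%N < 1)
  (X : 'M[R]_(m, n)) (rankX : \rank X = r) :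
  let gamma := rgd_gamma r A X in
  (gamma < 1 ->
   forall Xs : nat -> 'M[R]_(m, n), rgd_iterates r A (A X) Xs ->
   forall l : nat, normF (Xs l - X) <= gamma ^+ l * normF (Xs 0%N - X)) /\
  (ric A (3 * r)%N <= sigma_min X / sigma_max X * (12 * Num.sqrt r%:R)^-1 ->
   gamma < 1).
Proof.
move=> gamma; have r2 : (0 < 2 * r)%N by rewrite muln_gt0.
have r3 : (0 < 3 * r)%N by rewrite muln_gt0.
have [H2 _] := ric_least A m_gt0 n_gt0 r2.
have [H3 _] := ric_least A m_gt0 n_gt0 r3.
have d20 := ric_ge0 A m_gt0 n_gt0 r2; have d30 := ric_ge0 A m_gt0 n_gt0 r3.
have X0 : X != 0 by rewrite -mxrank_eq0 rankX -lt0n.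
have rX : (\rank X <= r)%N by rewrite rankX.
have smin := sigma_min_gt0 X0.
set d2 := ric A (2 * r) in ric2_lt1 H2 d20 *.
set d3 := ric A (3 * r) in H3 d30 *.
have d2' : 0 < 1 - d2 by rewrite subr_gt0.
split=> [gamma1 Xs [init steps]|d3_le].
  (* The first step already provides a decomposition of $X_0$ with [r] singular triples. *)
  have rX0 : (\rank (Xs 0%N) <= r)%N.
    have [U [s [V [[_ _ _ _ ->] _]]]] := steps 0%N.
    exact: leq_trans (mxrankM_maxl _ _) (mulmx_max_rank _ _).
  have e0 := initial_error r_lt d20 H2 rX rX0 init.
  have gamma0 : 0 <= gamma.
    rewrite addr_ge0 ?mulr_ge0 ?normF_ge0 ?invr_ge0 ?(ltW smin) ?(ltW d2') //.
    by rewrite addr_ge0 ?mulr_ge0.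
  elim=> [|l IH]; first by rewrite expr0 mul1r.
  have d2b : 0 <= d2 < 1 by rewrite d20.
  have := step_error r_lt d2b d30 H2 H3 X0 rX (steps l).
  set e := normF (Xs l - X) in IH * => step.
  (* As $\gamma^l \le 1$, the initial bound persists; it turns $2e/\sigma_{\min}$ into the last term
     of $\gamma$. *)
  have el : e <= 2 * d2 * normF X.
    apply: le_trans IH (le_trans _ e0).
    by rewrite ler_piMl ?normF_ge0 // exprn_ile1 // ltW.
  rewrite exprS -mulrA; apply: le_trans step (le_trans _ (ler_wpM2l gamma0 IH)).
  apply: ler_wpM2r; first exact: normF_ge0.
  rewrite lerD2l [leRHS]mulrAC; apply: ler_wpM2r; last by lra.
  by rewrite invr_ge0 ltW.
have d23 : d2 <= d3 by apply: ric_le => //; rewrite leq_mul2r orbT.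
have [t Xt t0] := singular_value_neq0_exists X0.
have min_max := le_trans (sigma_min_le Xt t0) (le_sigma_max Xt).
have normX := normF_le_sigma_max r_lt rX.
have smax : 0 < sigma_max X by exact: lt_le_trans min_max.
have s1 : 1 <= Num.sqrt r%:R :> R by rewrite -[leLHS]sqrtr1 ler_wsqrtr // ler1n.
set q := Num.sqrt _ in normX s1 d3_le.
have q0 : 0 < q by exact: lt_le_trans s1.
have d3q : 12 * (d3 * (q * sigma_max X)) <= sigma_min X.
  move: d3_le; rewrite -mulrA -invfM ler_pdivlMr ?mulr_gt0 // => h.
  by apply: le_trans h; lra.
(* Uses $\sigma_{\min} \le \sigma_{\max}$ and $\sqrt r \ge 1$. *)
have d312 : 12 * d3 <= 1.
  rewrite -(ler_pM2r smax) mul1r; apply: le_trans (le_trans d3q min_max).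
  rewrite -mulrA ler_wpM2l // ler_wpM2l // ler_peMl // ltW //.
(* $d_2 \le d_3 \le 1/12$ gives $(6/12)/(11/12)$; with the bound $4/12$ on the other term, $6/11 +
   1/3 = 29/33 < 1$. *)
have h1 : (4 * d2 + 2 * d3) / (1 - d2) <= 6 / 11 by rewrite ler_pdivrMr //; lra.
have h2 : 4 * d2 / sigma_min X * normF X <= 1 / 3.
  rewrite mulrAC ler_pdivrMr //.
  have : d2 * normF X <= d3 * (q * sigma_max X).
    by apply: ler_pM; rewrite ?normF_ge0.
  lra.
by rewrite /gamma /rgd_gamma -/d2 -/d3; lra.
Qed.
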